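(* Let $\mathcal X$ be locally convex and let $\rho$ be proper, convex and lower semicontinuous. Assume $(\mathcal X,\mathcal X')$ is an admissible pair, $\mathcal A$ is a closed convex cone with $\mathcal A\cap(-\mathcal A)=\{0\}$, $\mathcal P$ is closed, $V_0$ is lower semicontinuous, $V_1$ is anti-star shaped and upper semicontinuous, and $\mathcal L=\{0\}$. Then $\mathcal D_{str}$ is nonempty, $\sigma_{\mathcal A}(\psi)=0$ for every $\psi\in\mathcal D_{str}$, and $$\rho(X)=\sup_{\psi\in\mathcal D_{str}}\{\sigma_{\mathcal P,V_0,V_1}(\psi)-\psi(X)\}\quad\text{for all }X\in\mathcal X.$$
   Context: Standing setup: Let $\mathcal{X}$ be a real topological vector space partially ordered by a convex cone $\mathcal{X}_+\subset\mathcal X$; write $X\ge Y$ iff $X-Y\in\mathcal X_+$. Fix $N\in\mathbb N$ and: a set $\mathcal P\subset\mathbb R^N$ with $0\in\mathcal P$; a function $V_0:\mathbb R^N\to\mathbb R$ with $V_0(0)=0$ and $V_0(x)\ge -V_0(-x)$ for all $x\in\mathbb R^N$; a map $V_1:\mathbb R^N\to\mathcal X$ with $V_1(0)=0$ and $V_1(x)\le -V_1(-x)$ for all $x\in\mathbb R^N$; a set $\mathcal A\subset\mathcal X$ with $0\in\mathcal A$ and $\mathcal A+\mathcal X_+\subset\mathcal A$. The risk measure is $\rho:\mathcal X\to[-\infty,\infty]$, $\rho(X)=\inf\{V_0(x): x\in\mathcal P,\ X+V_1(x)\in\mathcal A\}$, with $\inf\emptyset=+\infty$. $\rho$ is proper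 if it never takes the value $-\infty$ and is not identically $+\infty$. $V_1$ is anti-star shaped if $V_1(\lambda x)\ge\lambda V_1(x)$ for all $\lambda\in[0,1]$, $x\in\mathbb R^N$; it is upper semicontinuous at $x$ if for every neighborhood $\mathcal U$ of $V_1(x)$ there exists a neighborhood $\mathcal V$ of $x$ with $V_1(\mathcal V)\subset\mathcal U-\mathcal X_+$, and upper semicontinuous if this holds at every $x$. Asymptotic notions: for a nonempty set $C$ in a topological vector space, $C^\infty=\{X:\exists\text{ nets }(X_\alpha)\subset C,\ (\lambda_\alpha)\subset[0,\infty),\ \lambda_\alpha\to0,\ \lambda_\alpha X_\alpha\to X\}$. For $f:\mathbb R^N\to\mathbb R$, its asymptotic function $f^\infty$ is the function whose epigraph equals $(\operatorname{epi}f)^\infty$, where $\operatorname{epi}f=\{(x,m)\in\mathbb R^N\times\mathbb R: f(x)\le m\}$. $\mathcal L=\{x\in\mathcal P^\infty: V_0^\infty(x)\le0,\ V_1(x)\in\mathcal A^\infty\}$. Duality notation: $\mathcal X'$ is the topological dual of $\mathcal X$. For $\psi\in\mathcal X'$: $\sigma_{\mathcal A}(\psi)=\inf_{X\in\mathcal A}\psi(X)$ and $\sigma_{\mathcal P,V_0,V_1}(\psi)=\inf_{x\in\mathcal P}\{V_0(x)-\psi(V_1(x))\}$. $\mathcal D=\{\psi\in\mathcal X':\sigma_{\mathcal A}(\psi)>-\infty,\ \sigma_{\mathcal P,V_0,V_1}(\psi)>-\infty\}$ and $\mathcal D_{str}=\{\psi\in\mathcal D:\psi(X)>0\ \forall X\in\mathcal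 A\setminus\{0\}\}$. $(\mathcal X,\mathcal X')$ is an admissible pair if there exists a separable normed space $\mathcal Y$ such that $\mathcal X'$ is (identified with) the norm dual of $\mathcal Y$ and the topology $\sigma(\mathcal X',\mathcal X)$ is weaker than $\sigma(\mathcal X',\mathcal Y)$. *)

(* Defs.v *)
From mathcomp Require Import all_boot all_algebra.
From mathcomp Require Import all_classical all_reals all_analysis.
Set Implicit Arguments.
Unset Strict Implicit.
Unset Printing Implicit Defensive.
Import GRing.Theory Num.Theory.
Import numFieldTopology.Exports numFieldNormedType.Exports.
Local Open Scope classical_set_scope.
Local Open Scope ring_scope.

Section Defs.
Variable R : realType.

Definition topdual (E : topologicalLmodType R) : set (E -> R) :=
  [set f | (forall (a : R) (x y : E), f (a *: x + y) = a * f x + f y)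
           /\ forall x : E, continuous_at x f].

Definition is_cone (E : lmodType R) (C : set E) : Prop :=
  C 0 /\ forall (l : R) (x : E), 0 <= l -> C x -> C (l *: x).

Definition is_convex_cone (E : lmodType R) (C : set E) : Prop :=
  is_cone C /\ convex_set (C : set (convex_lmodType E)).

Definition cone_le (E : lmodType R) (Xp : set E) (X Y : E) : Prop := Xp (Y - X).

Definition directed (I : Type) (le : I -> I -> Prop) : Prop :=
  inhabited I /\ (forall i, le i i) /\
  (forall i j k, le i j -> le j k -> le i k) /\
  (forall i j, exists k, le i k /\ le j k).

Definition net_cvg (I : Type) (le : I -> I -> Prop) (T : topologicalType)
  (x : I -> T) (l : T) : Prop :=
  forall U, nbhs l U -> exists i0, forall i, le i0 i -> U (x i).

Definition asym_cone (E : topologicalLmodType R) (C : set E) : set E :=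
  [set v | exists (I : Type) (le : I -> I -> Prop) (xs : I -> E) (ls : I -> R),
     directed le /\ (forall i, C (xs i)) /\ (forall i, 0 <= ls i) /\
     net_cvg le ls 0 /\ net_cvg le (fun i => ls i *: xs i) v].

Definition epi (N : nat) (f : 'rV[R]_N -> R) : set ('rV[R]_N * R^o) :=
  [set p | f p.1 <= p.2].

(** L = {x in P^oo : V0^oo(x) <= 0, V1(x) in A^oo}, where
    V0^oo(x) <= 0  iff  (x,0) in epi V0^oo = (epi V0)^oo *)
Definition Lset (N : nat) (E : tvsType R) (P : set 'rV[R]_N)
  (V0 : 'rV[R]_N -> R) (V1 : 'rV[R]_N -> E) (A : set E) : set 'rV[R]_N :=
  [set x | asym_cone P x /\ asym_cone (epi V0) (x, 0) /\ asym_cone A (V1 x)].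

Definition rho (N : nat) (E : tvsType R) (P : set 'rV[R]_N)
  (V0 : 'rV[R]_N -> R) (V1 : 'rV[R]_N -> E) (A : set E) (X : E) : \bar R :=
  ereal_inf [set (V0 x)%:E | x in [set x | P x /\ A (X + V1 x)]].

Definition proper_efun (T : Type) (f : T -> \bar R) : Prop :=
  (forall x, f x <> -oo%E) /\ exists x, f x <> +oo%E.

Definition convex_efun (E : lmodType R) (f : E -> \bar R) : Prop :=
  forall (x y : E) (l : R), 0 < l < 1 ->
    (f (l *: x + (1 - l) *: y)%R <= l%:E * f x + (1 - l)%:E * f y)%E.

Definition anti_star_shaped (N : nat) (E : lmodType R) (Xp : set E)
  (V1 : 'rV[R]_N -> E) : Prop :=
  forall (l : R) x, 0 <= l <= 1 -> cone_le Xp (l *: V1 x) (V1 (l *: x)).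

Definition usc_at (N : nat) (E : tvsType R) (Xp : set E)
  (V1 : 'rV[R]_N -> E) (x : 'rV[R]_N) : Prop :=
  forall U, nbhs (V1 x) U ->
    exists2 V, nbhs x V &
      forall z, V z -> exists u k, U u /\ Xp k /\ V1 z = u - k.

Definition usc (N : nat) (E : tvsType R) (Xp : set E) (V1 : 'rV[R]_N -> E) :=
  forall x, usc_at Xp V1 x.

Definition sigmaA (E : tvsType R) (A : set E) (psi : E -> R) : \bar R :=
  ereal_inf [set (psi X)%:E | X in A].

Definition sigmaPV (N : nat) (E : tvsType R) (P : set 'rV[R]_N)
  (V0 : 'rV[R]_N -> R) (V1 : 'rV[R]_N -> E) (psi : E -> R) : \bar R :=
  ereal_inf [set (V0 x - psi (V1 x))%:E | x in P].

Definition Dset (N : nat) (E : tvsType R) (P : set 'rV[R]_N)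
  (V0 : 'rV[R]_N -> R) (V1 : 'rV[R]_N -> E) (A : set E) : set (E -> R) :=
  [set psi | topdual psi /\ (-oo < sigmaA A psi)%E /\
             (-oo < sigmaPV P V0 V1 psi)%E].

Definition Dstr (N : nat) (E : tvsType R) (P : set 'rV[R]_N)
  (V0 : 'rV[R]_N -> R) (V1 : 'rV[R]_N -> E) (A : set E) : set (E -> R) :=
  [set psi | Dset P V0 V1 A psi /\ forall X, A X -> X <> 0 -> 0 < psi X].

Definition weak_open (F Pts : Type) (S : set F) (ev : F -> Pts -> R)
  (U : set F) : Prop :=
  U `<=` S /\
  forall f, U f -> exists (n : nat) (p : 'I_n -> Pts) (e : R), 0 < e /\
    forall g, S g -> (forall i, `|ev g (p i) - ev f (p i)| < e) -> U g.

Definition separable (T : topologicalType) : Prop :=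
  exists D : set T, countable D /\ dense D.

(** (X, X') admissible pair: X' is identified (linear bijection J) with the
    norm dual Y' of a separable normed space Y, and sigma(X',X) is weaker
    than sigma(X',Y) *)
Definition admissible_pair (E : tvsType R) : Prop :=
  exists (Y : normedModType R) (J : (Y -> R) -> (E -> R)),
    separable Y /\
    (forall f, topdual f -> topdual (J f)) /\
    (forall f g, topdual f -> topdual g -> J f = J g -> f = g) /\
    (forall psi, topdual psi -> exists2 f, topdual f & J f = psi) /\
    (forall (a : R) f g, topdual f -> topdual g ->
       J (fun y => a * f y + g y) = (fun x => a * J f x + J g x)) /\
    (forall U, weak_open (@topdual E) (fun psi x => psi x) U ->
       weak_open (@topdual Y) (fun f y => f y) [set f | topdual f /\ U (J f)]).

End Defs.

(* Main.v *)
Require Import Defs.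
From mathcomp Require Import all_boot all_order all_algebra.
From mathcomp Require Import all_classical all_reals all_analysis.
From mathcomp Require Import ring lra.
Set Implicit Arguments.
Unset Strict Implicit.
Unset Printing Implicit Defensive.
Import Order.TTheory GRing.Theory Num.Theory.
Import numFieldTopology.Exports numFieldNormedType.Exports.
Local Open Scope classical_set_scope.
Local Open Scope ring_scope.

(** Fenchel duality gives [rho X = sup over psi in D of sigmaPV psi - psi X]: a
    convex lower semicontinuous [rho] with [a < rho X0] lies above
    [a - q (Y - X0)] for some continuous sublinear [q], and Hahn-Banach
    (sandwiching a linear form between the two) yields an affine minorant, whose
    slope lies in [D]. Mixing such a slope with a small multiple of one strictly
    positive [psi0] replaces [D] by [Dstr], so everything reduces to finding one
    element of [Dstr]. The condition [L = {0}] makes [D] separate the points of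
    [A] from 0; separability of the predual makes [D] weakly separable, and a
    weighted sum of a countable weakly dense subfamily is strictly positive. *)

(** * Hahn-Banach and affine minorants of convex functions *)

Lemma linear_formE (R : realType) (E : lmodType R) (f : E -> R) :
  (forall (a : R) x y, f (a *: x + y) = a * f x + f y) ->
  [/\ f 0 = 0, (forall x y, f (x + y) = f x + f y),
     (forall (a : R) x, f (a *: x) = a * f x) & (forall x, f (- x) = - f x)].
Proof.
move=> flin.
have f0 : f 0 = 0 by have := flin (-1) 0 0; rewrite scaler0 addr0; lra.
split=> // [x y|a x|x].
- by rewrite -{1}[x]scale1r flin mul1r.
- by rewrite -[a *: x]addr0 flin f0 addr0.
- by rewrite -scaleN1r -[_ *: x]addr0 flin f0; lra.
Qed.

(** Extension step of Hahn-Banach, with a partial linear form encoded by its graph [G].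
    Subadditivity puts every [v.2 - p (v.1 - x)] below every [p (u.1 + x) - u.2], so the supremum of
    the former is a valid value at [x]. Rescaling by the modulus of [t] handles the other
    multiples. *)
Lemma dominated_one_step (R : realType) (E : lmodType R) (p : E -> R)
  (G : set (E * R^o)) (x : E) :
  (forall x y, p (x + y) <= p x + p y) ->
  (forall (t : R) x, 0 <= t -> p (t *: x) <= t * p x) ->
  G 0 -> (forall (a : R) u v, G u -> G v -> G (a *: u + v)) ->
  (forall u, G u -> u.2 <= p u.1) ->
  exists c : R, forall u (t : R), G u -> u.2 + t * c <= p (u.1 + t *: x).
Proof.
move=> padd pscale G0 Glin Gp.
pose S := [set u.2 - p (u.1 - x) | u in G].
have ubS : forall u, G u -> ubound S (p (u.1 + x) - u.2).
  move=> u Gu _ [v Gv <-].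
  have /Gp/= := Glin 1 u v Gu Gv; rewrite !scale1r => h.
  have := padd (u.1 + x) (v.1 - x); rewrite addrACA subrr addr0.
  by move: h; lra.
have S0 : S !=set0 by exists (0 - p (0 - x)), 0.
exists (sup S) => u t Gu.
have scal : forall s y, 0 < s -> s * p (s^-1 *: y) <= p y.
  move=> s y s0; rewrite mulrC -ler_pdivlMr// mulrC.
  by apply: pscale; rewrite invr_ge0 ltW.
have Gs : forall a : R, G (a *: u).
  by move=> a; rewrite -[_ *: u]addr0; apply: Glin.
have [t0|t0|->] := ltgtP t 0; last first.
- by rewrite mul0r scale0r !addr0; exact: Gp.
- have := @ge_sup _ _ _ S0 (ubS (t^-1 *: u) (Gs _)).
  have := scal t (u.1 + t *: x) t0.
  rewrite scalerDr scalerA mulVf ?gt_eqF// scale1r /= /GRing.scale/= => h1 h2.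
  have : t * sup S <= t * (p (t^-1 *: u.1 + x) - t^-1 * u.2) by rewrite ler_pM2l.
  rewrite mulrBr mulrA divff ?gt_eqF// mul1r; move: h1; rewrite /GRing.scale/=; lra.
- have s0 : 0 < - t by rewrite oppr_gt0.
  have : S ((- t)^-1 * u.2 - p ((- t)^-1 *: u.1 - x)) by exists ((- t)^-1 *: u).
  move=> /(ub_le_sup _) => /(_ (ex_intro _ _ (ubS 0 G0))) h2.
  have := scal (- t) (u.1 + t *: x) s0.
  have tx : (- t)^-1 *: (t *: x) = - x.
    by rewrite scalerA invrN mulNr mulVf ?lt_eqF// scaleN1r.
  rewrite scalerDr tx => h1.
  have : - t * ((- t)^-1 * u.2 - p ((- t)^-1 *: u.1 - x)) <= - t * sup S.
    by rewrite ler_pM2l.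
  rewrite mulrBr mulrA divff ?gt_eqF// mul1r; move: h1; lra.
Qed.

Lemma hahn_banach_dominated (R : realType) (E : lmodType R) (p : E -> R) :
  (forall x y, p (x + y) <= p x + p y) ->
  (forall (t : R) x, 0 <= t -> p (t *: x) <= t * p x) ->
  exists2 f : E -> R, (forall (a : R) x y, f (a *: x + y) = a * f x + f y) &
    forall x, f x <= p x.
Proof.
move=> padd pscale.
pose Q (G : set (E * R^o)) :=
  (forall (a : R) u v, G u -> G v -> G (a *: u + v)) /\
  (forall u, G u -> u.2 <= p u.1).
have p0 : 0 <= p 0 by have := padd 0 0; rewrite addr0; lra.
have p0' : p 0 <= 0 by have := @pscale 0 0 (lexx _); rewrite scale0r mul0r.
have [F FQ totF|G [[Glin Gp] Gmax]] := @Zorn_bigcup _ Q.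
  split=> [a u v [X FX Xu] [Y FY Yv]|u [X FX Xu]]; last exact: (FQ _ FX).2.
  have [XY|YX] := totF _ _ FX FY.
    by exists Y => //; apply: (FQ _ FY).1 => //; exact: XY.
  by exists X => //; apply: (FQ _ FX).1 => //; exact: YX.
(* The empty graph satisfies [Q], so maximality is needed here: a nonempty [G] contains [u - u], and
   an empty one would be strictly inside [[set 0]]. *)
have G0 : G 0.
  apply: contrapT => nG0.
  have [[u Gu]|nG] := pselect (G !=set0).
    apply: nG0; have := Glin (-1) u u Gu Gu.
    by rewrite scaleN1r addNr.
  apply: (Gmax [set 0]); first split.
  - by move=> u Gu; case: nG; exists u.
  - by move=> H; apply: nG0; apply: H.
  - split=> [a u v -> ->|u ->]; last exact: p0.
    by rewrite scaler0 addr0.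
have tot : forall x, exists c : R, G (x, c).
  move=> x; apply: contrapT => nx.
  have [c hc] := @dominated_one_step R E p G x padd pscale G0 Glin Gp.
  pose B : set (E * R^o) := [set w | exists2 u, G u & exists t : R,
     w = (u.1 + t *: x, u.2 + t * c)].
  have GB : G `<=` B.
    by move=> u Gu; exists u => //; exists 0; rewrite scale0r mul0r !addr0; case: u Gu.
  apply: (Gmax B); first split => //.
  - move=> BG; apply: nx; exists c; apply: BG; exists 0 => //; exists 1.
    by rewrite scale1r mul1r !add0r.
  - split=> [a w w' [u Gu [t ->]] [v Gv [s ->]]|w [u Gu [t ->]]]; last exact: hc.
    exists (a *: u + v); first exact: Glin.
    exists (a * t + s); congr (_, _); rewrite /=.
      by rewrite scalerDr scalerA scalerDl addrACA.
    by rewrite /GRing.scale/=; ring.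
(* Domination alone makes the graph functional: both [c] and [- c] are at most [p 0 = 0]. *)
have uniq0 : forall c : R, G (0, c) -> c = 0.
  move=> c Gc; apply/eqP; rewrite eq_le.
  have h1 := Gp _ Gc; have := Gp _ (Glin (-1) _ _ Gc G0); rewrite /= addr0.
  rewrite scaler0 addr0 scaleN1r; move: h1 => /=; lra.
have uniqG : forall x (c d : R), G (x, c) -> G (x, d) -> c = d.
  move=> x c d Gc Gd; have := Glin (-1) _ _ Gd Gc.
  rewrite scaleN1r; set w := (X in G X).
  have -> : w = (0, c - d) by rewrite /w; congr (_, _) => /=; rewrite addrC ?subrr.
  by move=> /uniq0; lra.
have [f Gf] := choice tot.
exists f => [a x y|x]; last exact: (Gp _ (Gf x)).
apply: uniqG (Gf _) _; exact: (Glin a _ _ (Gf x) (Gf y)).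
Qed.

Lemma convex_setP01 (R : realType) (E : lmodType R) (B : set E) (x y : E) (t : R) :
  convex_set (B : set (convex_lmodType E)) -> 0 <= t <= 1 ->
  B x -> B y -> B (t *: x + (1 - t) *: y).
Proof.
move=> cB /andP[t0 t1] Bx By.
have := cB x y (Itv01 t0 t1).
by rewrite !inE => /(_ Bx By).
Qed.

Lemma scale_near0 (R : realType) (E : tvsType R) (U : set E) (x : E) :
  nbhs 0 U -> \forall t \near (0 : R), U (t *: x).
Proof.
move=> U0; have := @scale_continuous R E (0, x) U.
rewrite /= scale0r => /(_ U0)[] [A B]/= [A0 Bx] AB.
near=> t; apply: (AB (t, x)); split => /=; last exact: nbhs_singleton.
near: t; exact: A0.
Unshelve. all: by end_near. Qed.

(** An asymmetric continuous seminorm. Homogeneity is stated as an inequality, whose converse for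
    [t > 0] follows by applying it to [t^-1]; as [q] is nonnegative, the last clause is continuity
    at 0. *)
Definition cts_sublinear (R : realType) (E : tvsType R) (q : E -> R) : Prop :=
  [/\ (forall x y, q (x + y) <= q x + q y),
      (forall (t : R) x, 0 <= t -> q (t *: x) <= t * q x),
      (forall x, 0 <= q x) &
      (forall e, 0 < e -> nbhs 0 [set x | q x < e])].

(** The Minkowski gauge of an open convex neighbourhood [B] of 0 inside [U], provided by local
    convexity. *)
Lemma exists_sublinear_gauge (R : realType) (E : tvsType R) (U : set E) :
  nbhs 0 U -> exists2 q : E -> R, cts_sublinear q & (forall x, q x < 1 -> U x).
Proof.
move=> U0; have [BB cBB [oBB bBB]] := @locally_convex R E.
have [B /= [BBB B0] BU] := bBB 0 U U0.
have cB := cBB B (mem_set BBB).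
have nB : nbhs 0 B by apply: open_nbhs_nbhs; split => //; exact: oBB.
pose S x := [set s : R | 0 < s /\ B (s^-1 *: x)].
have S0 x : S x !=set0.
  have := @scale_near0 R E B x nB; move=> /nbhs_ballP[e/= e0 eB].
  exists (e / 2)^-1; split; first by rewrite invr_gt0 divr_gt0.
  by rewrite invrK; apply: eB; rewrite /ball/= sub0r normrN gtr0_norm ?divr_gt0//; lra.
have lS x : lbound (S x) 0 by move=> s [/ltW].
(* Since [B] is convex and contains 0, [S x] is upward closed; hence every [s] above its infimum
   belongs to it. *)
have Sup x s r : S x s -> s <= r -> S x r.
  move=> [s0 Bs] sr; have r0 : 0 < r by lra.
  split => //; have -> : r^-1 *: x = (s / r) *: (s^-1 *: x) + (1 - s / r) *: 0.
    by rewrite scaler0 addr0 scalerA mulrAC divff ?mul1r// gt_eqF.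
  apply: convex_setP01 => //; apply/andP; split; first by rewrite divr_ge0 ?ltW.
  by rewrite ler_pdivrMr// mul1r.
have Slt x s : inf (S x) < s -> S x s.
  by move=> /(inf_lt (S0 x))[r Sr /ltW]; exact: Sup.
exists (fun x => inf (S x)); last first.
  by move=> x /Slt[_]; rewrite invr1 scale1r; exact: BU.
split.
- move=> x y; apply/ler_addgt0Pr => e e0.
  have [|s0 Bs] := Slt x (inf (S x) + e / 2); first by lra.
  have [|r0 Br] := Slt y (inf (S y) + e / 2); first by lra.
  set s := inf (S x) + _ in s0 Bs; set r := inf (S y) + _ in r0 Br.
  have -> : inf (S x) + inf (S y) + e = s + r by rewrite /s /r; lra.
  apply: inf_lbound; first by exists 0.
  have sr : 0 < s + r by lra.
  split => //.
  have -> : (s + r)^-1 *: (x + y) =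
     (s / (s + r)) *: (s^-1 *: x) + (1 - s / (s + r)) *: (r^-1 *: y).
    rewrite !scalerA scalerDr; congr (_ *: _ + _ *: _); field;
      by rewrite ?gt_eqF.
  apply: convex_setP01 => //; apply/andP; split; first by rewrite divr_ge0 ?ltW.
  by rewrite ler_pdivrMr//; lra.
- move=> t x; rewrite le_eqVlt => /orP[/eqP <-|t0].
    rewrite scale0r mul0r; apply/ler_addgt0Pr => e e0; rewrite add0r.
    by apply: inf_lbound; [exists 0|split => //; rewrite scaler0].
  rewrite mulrC -ler_pdivrMr//; apply: lb_le_inf => // s [s0 Bs].
  rewrite ler_pdivrMr//; apply: inf_lbound; first by exists 0.
  split; first exact: mulr_gt0.
  by rewrite scalerA; have -> : (s * t)^-1 * t = s^-1 by field; rewrite !gt_eqF.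
- by move=> x; apply: lb_le_inf.
- move=> e e0; have e2 : e / 2 != 0 by rewrite gt_eqF ?divr_gt0.
  apply: filterS (nbhs0Z e2 nB) => _ [x Bx <-] /=.
  apply: (@le_lt_trans _ _ (e / 2)); last by lra.
  apply: inf_lbound; first by exists 0.
  by split; [exact: divr_gt0|rewrite scalerA mulVf// scale1r].
Qed.

Lemma dominated_topdual (R : realType) (E : tvsType R) (q f : E -> R) :
  cts_sublinear q -> (forall (a : R) x y, f (a *: x + y) = a * f x + f y) ->
  (forall x, f x <= q x) -> topdual f.
Proof.
move=> [_ _ _ q0] flin fq; split => // x; apply/cvgrPdist_lt => e e0.
have nU : nbhs 0 ([set x | q x < e] `&` (-%R @` [set x | q x < e])).
  by apply: filterI; [exact: q0|exact/nbhs0N/q0].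
apply: filterS (nbhsT x nU) => _ [z [/= qz [w qw wz]] <-].
have [_ fD _ fN] := linear_formE flin.
have := le_lt_trans (fq z) qz; have := le_lt_trans (fq w) qw.
rewrite ltr_norml fD -wz fN; lra.
Qed.

(** Hahn-Banach is applied to the infimum of [q (x + u.1) + u.2] over the convex cone [K]. It is
    finite because it is at least [- q (- x)], it is sublinear because [K] is a cone, and
    [u = (0, 0)] gives the bound by [q]. At [- u.1] it is at most [u.2], which is the second bound
    on [f]. *)
Lemma sublinear_sandwich (R : realType) (E : lmodType R) (q : E -> R)
  (K : set (E * R)) :
  (forall x y, q (x + y) <= q x + q y) ->
  (forall (t : R) x, 0 <= t -> q (t *: x) <= t * q x) ->
  K (0, 0) -> (forall u v, K u -> K v -> K (u.1 + v.1, u.2 + v.2)) ->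
  (forall (t : R) u, 0 <= t -> K u -> K (t *: u.1, t * u.2)) ->
  (forall u, K u -> 0 <= q u.1 + u.2) ->
  exists f : E -> R, [/\ (forall (a : R) x y, f (a *: x + y) = a * f x + f y),
    (forall x, f x <= q x) & (forall u, K u -> 0 <= f u.1 + u.2)].
Proof.
move=> qadd qscale K0 Kadd Kscale qK.
pose S x := [set q (x + u.1) + u.2 | u in K].
have S0 x : S x !=set0 by exists (q (x + 0) + 0), (0, 0).
have lS x : lbound (S x) (- q (- x)).
  move=> _ [u Ku <-]; have := qadd (x + u.1) (- x); rewrite addrAC subrr add0r.
  by have := qK u Ku; lra.
have Sinf x u : K u -> inf (S x) <= q (x + u.1) + u.2.
  by move=> Ku; apply: ge_inf; [exists (- q (- x)); exact: lS|exists u].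
have q0 : q 0 <= 0 by have := qscale 0 0 (lexx _); rewrite scale0r mul0r.
have [|t x t0|f flin fp] := @hahn_banach_dominated R E (fun x => inf (S x)).
- move=> x y; apply/ler_addgt0Pr => e e0.
  have [|_ [u Ku <-] hu] := @inf_lt _ (S x) (inf (S x) + e / 2) (S0 x); first by lra.
  have [|_ [v Kv <-] hv] := @inf_lt _ (S y) (inf (S y) + e / 2) (S0 y); first by lra.
  have := Sinf (x + y) _ (Kadd _ _ Ku Kv); rewrite /= addrACA.
  by have := qadd (x + u.1) (y + v.1); lra.
- have [<-|tn0] := eqVneq 0 t.
    by rewrite mul0r scale0r; have := Sinf 0 _ K0; rewrite /= !addr0; lra.
  have tp : 0 < t by rewrite lt_neqAle tn0.
  rewrite mulrC -ler_pdivrMr//; apply: lb_le_inf => // _ [u Ku <-].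
  rewrite ler_pdivrMr//; apply: le_trans (Sinf _ _ (Kscale t u t0 Ku)) _.
  rewrite /= -scalerDr mulrDl [u.2 * t]mulrC lerD2r mulrC.
  exact: qscale.
exists f; split => // [x|u Ku].
  by have := fp x; have := Sinf x _ K0; rewrite /= !addr0; lra.
have [_ _ _ fN] := linear_formE flin.
have := fp (- u.1); have := Sinf (- u.1) u Ku; rewrite addNr fN; lra.
Qed.

Lemma convex_efun_le (R : realType) (E : lmodType R) (f : E -> \bar R)
  (x y : E) (mx my t : R) :
  convex_efun f -> 0 <= t <= 1 -> (f x <= mx%:E)%E -> (f y <= my%:E)%E ->
  (f (t *: x + (1 - t) *: y)%R <= (t * mx + (1 - t) * my)%R%:E)%E.
Proof.
move=> cf /andP[]; rewrite le_eqVlt => /orP[/eqP <- _ _ fy|t0].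
  by rewrite scale0r mul0r subr0 scale1r mul1r !add0r.
rewrite le_eqVlt => /orP[/eqP -> fx _|t1 fx fy].
  by rewrite subrr scale0r mul0r scale1r mul1r !addr0.
apply: le_trans (cf x y t _) _; first by rewrite t0.
rewrite [leRHS]EFinD !EFinM; apply: leeD; apply: lee_wpmul2l => //; rewrite lee_fin; lra.
Qed.

Lemma nbhs_translate0 (R : realType) (E : tvsType R) (x : E) (V : set E) :
  nbhs x V -> nbhs 0 [set z | V (x + z)].
Proof.
move=> /(nbhsB (- x)); rewrite addNr; apply: filterS => _ [z Vz <-] /=.
by rewrite addrA subrr add0r.
Qed.

(** Lower semicontinuity at a point [X1] of finiteness, spread by convexity along segments, bounds
    [f] below everywhere by a constant minus [q1]. Near [X0], where [q0 < 1], the bound [a] is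
    direct; elsewhere [q0 >= 1], and the term [M * q0] covers the gap between [a] and the global
    bound. *)
Lemma convex_lsc_ge_gauge (R : realType) (E : tvsType R) (f : E -> \bar R)
  (X0 : E) (a : R) :
  proper_efun f -> convex_efun f -> lower_semicontinuous f -> (a%:E < f X0)%E ->
  exists2 q : E -> R, cts_sublinear q &
    forall Y m, (f Y <= m%:E)%E -> a - q (Y - X0) <= m.
Proof.
move=> [fNy [X1 fX1]] cf lf aX0.
have [r fr] : exists r : R, f X1 = r%:E.
  by case: (f X1) fX1 (fNy X1) => [r| |]// _ _; exists r.
have [|V nV fV] := lf X1 (r - 1); first by rewrite fr lte_fin; lra.
have [q1 [q1add q1sc q1ge q1n] q1V] := exists_sublinear_gauge (nbhs_translate0 nV).
have low Y m : (f Y <= m%:E)%E -> r - 2 - q1 (Y - X1) <= m.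
  move=> fY; set s := q1 _; have s0 : 0 <= s by exact: q1ge.
  have s2 : 0 < s + 2 by lra.
  (* With this [t], [t * s < 1] keeps [X1 + t (Y - X1)] in [V], where [f] exceeds [r - 1]; convexity
     then yields [m > r - (s + 2)]. *)
  pose t := (s + 2)^-1; have t0 : 0 < t by rewrite invr_gt0.
  have ts : t * (s + 2) = 1 by rewrite /t mulVf// gt_eqF.
  have t1 : t <= 1 by rewrite invf_le1//; lra.
  have := @convex_efun_le R E f Y X1 m r t cf.
  rewrite (ltW t0) t1 fr lexx => /(_ isT fY isT).
  have -> : t *: Y + (1 - t) *: X1 = X1 + t *: (Y - X1).
    by rewrite scalerBl scale1r scalerBr addrCA addrA.
  have : q1 (t *: (Y - X1)) < 1.
    by apply: le_lt_trans (q1sc _ _ (ltW t0)) _; rewrite -/s; nra.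
  move=> /q1V /fV h1 h2; have := lt_le_trans h1 h2.
  by rewrite lte_fin; nra.
have [W nW fW] := lf X0 a aX0.
have [q0 [q0add q0sc q0ge q0n] q0V] := exists_sublinear_gauge (nbhs_translate0 nW).
pose M := `|a - (r - 2 - q1 (X0 - X1))|.
have M0 : 0 <= M by exact: normr_ge0.
exists (fun x => q1 x + M * q0 x).
  split.
  - by move=> x y; have := q1add x y; have := q0add x y; nra.
  - by move=> t x t0; have := q1sc t x t0; have := q0sc t x t0; nra.
  - by move=> x; rewrite addr_ge0// mulr_ge0.
  - move=> e e0.
    have e2 : 0 < e / 2 by lra.
    have e3 : 0 < e / 2 / (M + 1) by rewrite divr_gt0//; lra.
    apply: filterS (filterI (q1n _ e2) (q0n _ e3)) => x [/= h1].
    rewrite ltr_pdivlMr; last by lra.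
    by have := q0ge x; nra.
move=> Y m fY; have [q01|q01] := ltP (q0 (Y - X0)) 1.
  have := fW _ (q0V _ q01); rewrite addrC subrK => /lt_le_trans/(_ fY).
  rewrite lte_fin; have := q1ge (Y - X0); have := q0ge (Y - X0); nra.
have := low Y m fY; have := q1add (Y - X0) (X0 - X1); rewrite addrA subrK.
have : a - (r - 2 - q1 (X0 - X1)) <= M by exact: ler_norm.
nra.
Qed.

(** The sandwich is applied to the cone [K] generated by the epigraph of [f] translated by
    [(- X0, - a)]; the gauge bound says exactly that [q u.1 + u.2] is nonnegative on it. The slope
    is [- l], matching the sign of [psi] in the dual formula. *)
Lemma convex_lsc_affine_minorant (R : realType) (E : tvsType R) (f : E -> \bar R)
  (X0 : E) (a : R) :
  proper_efun f -> convex_efun f -> lower_semicontinuous f -> (a%:E < f X0)%E ->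
  exists2 l : E -> R, topdual l &
    forall Y m, (f Y <= m%:E)%E -> a + l X0 - l Y <= m.
Proof.
move=> pf cf lf aX0.
have [q cq qf] := convex_lsc_ge_gauge pf cf lf aX0.
have [qadd qsc qge _] := cq.
pose K : set (E * R) := [set u | exists t Y m,
   [/\ 0 <= t, (f Y <= m%:E)%E & u = (t *: (Y - X0), t * (m - a))]].
have fin : exists X1 r, (f X1 <= r%:E)%E.
  case: pf => fN [X1 X1y]; exists X1; case: (f X1) X1y (fN X1) => [r| |]// _ _.
  by exists r.
have K0 : K (0, 0).
  have [X1 [r fr]] := fin.
  by exists 0, X1, r; split => //; rewrite scale0r mul0r.
have Kadd u v : K u -> K v -> K (u.1 + v.1, u.2 + v.2).
  move=> [t [Y [m [t0 fY ->]]]] [s [Z [n [s0 fZ ->]]]] /=.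
  have [ts0|tsn0] := eqVneq 0 (t + s).
    have [-> ->] : t = 0 /\ s = 0 by split; lra.
    by rewrite !scale0r !mul0r !addr0.
  have ts : 0 < t + s by rewrite lt_neqAle tsn0 addr_ge0.
  have c1 : 1 - t / (t + s) = s / (t + s) by field; rewrite gt_eqF.
  exists (t + s), (t / (t + s) *: Y + (1 - t / (t + s)) *: Z),
    (t / (t + s) * m + (1 - t / (t + s)) * n); split; first exact: ltW.
    apply: convex_efun_le => //; apply/andP; split; first by rewrite divr_ge0// ltW.
    by rewrite ler_pdivrMr// mul1r; lra.
  rewrite c1; congr (_, _); last by field; rewrite gt_eqF.
  rewrite [in RHS]scalerBr [in RHS]scalerDr !scalerA !(mulrC (t + s)) !mulfVK ?gt_eqF//.
  by rewrite scalerDl !scalerBr opprD addrACA.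
have Ksc (t : R) u : 0 <= t -> K u -> K (t *: u.1, t * u.2).
  move=> t0 [s [Y [m [s0 fY ->]]]]; exists (t * s), Y, m.
  by rewrite mulr_ge0// scalerA mulrA; split.
have qK u : K u -> 0 <= q u.1 + u.2.
  move=> [t [Y [m [t0 fY ->]]]] /=.
  have : t * q (Y - X0) <= q (t *: (Y - X0)).
    have [<-|tn0] := eqVneq 0 t; first by rewrite mul0r.
    have tp : 0 < t by rewrite lt_neqAle tn0.
    rewrite mulrC -ler_pdivlMr// mulrC.
    have := qsc t^-1 (t *: (Y - X0)); rewrite scalerA mulVf ?gt_eqF// scale1r.
    by apply; rewrite invr_ge0.
  by have := qf Y m fY; nra.
have [l [llin lq lK]] := sublinear_sandwich qadd qsc K0 Kadd Ksc qK.
exists l; first exact: dominated_topdual cq llin lq.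
move=> Y m fY; have : K (Y - X0, m - a).
  by exists 1, Y, m; rewrite scale1r mul1r; split.
move=> /lK /=; have := llin (-1) X0 Y; rewrite scaleN1r addrC; lra.
Qed.

(** * Weighted sums in the dual of a separable normed space *)

(** The bound is a natural number so that it can be part of the countable codes of
    [weak_dense_sequence]. *)
Lemma topdual_bounded (R : realType) (Y : normedModType R) (f : Y -> R) :
  topdual f -> exists b : nat, forall y, `|f y| <= b%:R * `|y|.
Proof.
move=> [flin fc]; have [f0 _ fZ _] := linear_formE flin.
have /cvgrPdist_lt/(_ 1 ltr01) := fc 0.
move=> /nbhs_ballP[e /= e0 he].
exists (Num.bound (2 / e)) => y.
have [->|yn0] := eqVneq y 0; first by rewrite f0 !normr0 mulr0.
have y0 : 0 < `|y| by rewrite normr_gt0.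
have c0 : 0 < e / 2 / `|y| by rewrite !divr_gt0.
have : `|f 0 - f ((e / 2 / `|y|) *: y)| < 1.
  apply: he; rewrite -ball_normE /ball_ /= sub0r normrN normrZ.
  by rewrite (gtr0_norm c0) divfK ?gt_eqF//; lra.
rewrite f0 sub0r normrN fZ normrM (gtr0_norm c0).
have b0 : 2 / e < (Num.bound (2 / e))%:R by apply: archi_boundP; rewrite divr_ge0// ltW.
rewrite -ltr_pdivlMl// mulr1 invf_div => /ltW /le_trans; apply.
by rewrite mulrC invf_div ler_pM2r// ltW.
Qed.

Lemma bounded_topdual (R : realType) (Y : normedModType R) (f : Y -> R) (b : R) :
  (forall (a : R) x y, f (a *: x + y) = a * f x + f y) ->
  (forall y, `|f y| <= b * `|y|) -> topdual f.
Proof.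
move=> flin fb; have [f0 fD fZ fN] := linear_formE flin.
split=> // x; apply/cvgrPdist_lt => e e0.
have b1 : 0 < `|b| + 1 by rewrite ltr_wpDl.
apply/nbhs_ballP; exists (e / (`|b| + 1)) => /=; first exact: divr_gt0.
move=> y; rewrite -ball_normE /ball_ /= ltr_pdivlMr// => xy.
rewrite -fN -fD; apply: le_lt_trans (fb _) _.
have := ler_norm b; have := normr_ge0 (x - y); nra.
Qed.

Lemma separable_seq_dense (R : realType) (Y : normedModType R) :
  separable Y -> exists d : nat -> Y, forall y e, 0 < e -> exists n, `|y - d n| < e.
Proof.
move=> [D [cD dD]].
have /pfcard_geP[D0|[f]] : (D #<= [set: nat])%card by [].
  have [] := dD setT; first by exists 0.
  - exact: openT.
  - by move=> x []; rewrite D0.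
exists f => y e e0.
have [|z [yz Dz]] := dD _ _ (@open_interior _ (ball y e)).
  by exists y; apply: nbhsx_ballx.
have [n _ nz] := @surj _ _ _ _ f _ Dz.
by exists n; rewrite nz; have := interior_subset yz; rewrite -ball_normE.
Qed.

(** A code [t] records finitely many rational values at points of a dense sequence, a norm bound and
    a precision. There are countably many codes, and one element of [D] is chosen for each
    realizable one. The shared norm bound carries closeness from the dense points to the given
    [p j], at a cost of four errors below [e / 4]. *)
Lemma weak_dense_sequence (R : realType) (Y : normedModType R) (D : set (Y -> R)) :
  separable Y -> D `<=` @topdual R Y -> D !=set0 ->
  exists2 g : nat -> Y -> R, (forall i, D (g i)) &
    forall f n (p : 'I_n -> Y) e, D f -> 0 < e ->
      exists i, forall j, `|g i (p j) - f (p j)| < e.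
Proof.
move=> /separable_seq_dense[d dd] Ddual [g0 Dg0].
pose T : Type := (seq (nat * rat) * nat * nat)%type.
pose good (t : T) (g : Y -> R) := [/\ D g, (forall y, `|g y| <= t.1.2%:R * `|y|) &
  forall u, u \in t.1.1 -> `|g (d u.1) - ratr u.2| < t.2.+1%:R^-1].
(* Indices that code nothing, or whose code no element of [D] realizes, get the default [g0]. *)
have /choice[g gP] : forall i : nat, exists g, D g /\
    forall t : T, unpickle i = Some t -> (exists h, good t h) -> good t g.
  move=> i; have [[t [ti [h hg]]]|nt] :=
    pselect (exists t : T, unpickle i = Some t /\ exists h, good t h).
    exists h; split; first by case: hg.
    by move=> t'; rewrite ti => -[<-].
  by exists g0; split => // t ti th; case: nt; exists t.
exists g => [i|f n p e Df e0]; first exact: (gP i).1.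
have [b fb] := topdual_bounded (Ddual _ Df).
pose m := Num.bound (4 / e).
have m4 : m.+1%:R^-1 < e / 4 :> R.
  have : 4 / e < m%:R by apply: archi_boundP; rewrite divr_ge0// ltW.
  rewrite -[e / 4]invf_div ltf_pV2 ?posrE ?divr_gt0//; last by lra.
have m0 : 0 < m.+1%:R^-1 :> R by rewrite invr_gt0.
have [q qE] : exists q : R, q = m.+1%:R^-1 by exists m.+1%:R^-1.
rewrite -qE in m4 m0.
have b1 : 0 < b%:R + 1 :> R by rewrite ltr_wpDl.
have /choice[k kP] : forall j : 'I_n, exists k, `|p j - d k| < e / 4 / (b%:R + 1).
  by move=> j; apply: dd; rewrite !divr_gt0.
have /choice[r rP] : forall j : 'I_n, exists r : rat, `|f (d (k j)) - ratr r| < q.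
  move=> j; have [|r] := @rat_in_itvoo _ (f (d (k j)) - q) (f (d (k j)) + q).
    by lra.
  by rewrite in_itv/= => rr; exists r; rewrite ltr_norml; lra.
pose t : T := ([seq (k j, r j) | j <- enum 'I_n], b, m).
have [|Dg gb gr] := (gP (pickle t)).2 t (pickleK t).
  exists f; split => // u /mapP[j _ ->]; rewrite /= -qE; exact: rP.
exists (pickle t) => j.
have [_ gD _ gN] := linear_formE (Ddual _ Dg).1.
have [_ fD _ fN] := linear_formE (Ddual _ Df).1.
set h := g (pickle t) in Dg gb gr gD gN *.
have h1 : `|h (p j - d (k j))| < e / 4.
  apply: le_lt_trans (gb _) _; have := kP j; rewrite ltr_pdivlMr//=.
  by have := normr_ge0 (p j - d (k j)); nra.
have h2 : `|f (p j - d (k j))| < e / 4.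
  apply: le_lt_trans (fb _) _; have := kP j; rewrite ltr_pdivlMr//=.
  by have := normr_ge0 (p j - d (k j)); nra.
have h3 := rP j.
have h4 : `|h (d (k j)) - ratr (r j)| < q.
  by rewrite qE; apply: (gr (k j, r j)); apply: map_f; rewrite mem_enum.
move: h1 h2 h3 h4; rewrite gD gN fD fN !ltr_norml; lra.
Qed.

Lemma sum_half_le1 (R : realType) (n : nat) :
  \sum_(0 <= i < n) (2 ^- i.+1 : R) <= 1.
Proof.
suff -> : \sum_(0 <= i < n) (2 ^- i.+1 : R) = 1 - 2 ^- n.
  by rewrite gerBl invr_ge0 exprn_ge0.
elim: n => [|n IH]; first by rewrite big_nil expr0 invr1 subrr.
rewrite big_nat_recr//= IH exprS invfM; lra.
Qed.

Lemma half_dominated_series (R : realType) (u : nat -> R) (M : R) :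
  0 <= M -> (forall i, `|u i| <= 2 ^- i.+1 * M) ->
  exists2 l : R, series u @ \oo --> l & `|l| <= M.
Proof.
move=> M0 uM.
have nM n : [normed series u] n <= M.
  rewrite /=; apply: le_trans (ler_sum _ (fun i _ => uM i)) _.
  by rewrite -mulr_suml ler_piMl// sum_half_le1.
have cn : cvgn [normed series u].
  apply: nondecreasing_is_cvgn; last by exists M => _ [n _ <-].
  by move=> a b ab; apply: (@nondecreasing_series _ (fun k => `|u k|) xpredT 0%N).
have cu := normed_cvg cn.
exists (limn (series u)) => //.
apply: le_trans (lim_series_norm cn) _; apply: limr_le => //.
by near=> n; exact: nM.
Unshelve. all: by end_near. Qed.

Lemma series_topdual (R : realType) (Y : normedModType R)
  (g : nat -> Y -> R) (w : nat -> R) :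
  (forall i, topdual (g i)) -> (forall i y, `|w i * g i y| <= 2 ^- i.+1 * `|y|) ->
  exists2 F : Y -> R, topdual F &
    forall y, series (fun i => w i * g i y) @ \oo --> F y.
Proof.
move=> gd gw.
have /choice[F FP] : forall y, exists l : R,
    series (fun i => w i * g i y) @ \oo --> l /\ `|l| <= `|y|.
  move=> y; have [|l ul lM] := @half_dominated_series R _ `|y| _ (gw ^~ y) => //.
  by exists l.
exists F => [|y]; last exact: (FP y).1.
apply: (@bounded_topdual _ _ _ 1) => [a x y|y]; last by rewrite mul1r; exact: (FP y).2.
apply: (cvg_unique _ (FP _).1); first exact: Rhausdorff.
rewrite (_ : series _ = fun n => a * series (fun i => w i * g i x) n +
    series (fun i => w i * g i y) n).
  by apply: cvgD; [apply: cvgMl_tmp; exact: (FP x).1|exact: (FP y).1].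
apply/funext => n; rewrite /series/= mulr_sumr -big_split/=; apply: eq_bigr => i _.
by rewrite (gd i).1; ring.
Qed.

Lemma topdual_comb (R : realType) (E : topologicalLmodType R) (a : R) (f g : E -> R) :
  topdual f -> topdual g -> topdual (fun x => a * f x + g x).
Proof.
move=> [fl fc] [gl gc]; split=> [b x y|x]; first by rewrite fl gl; ring.
by apply: cvgD; [apply: cvgMl_tmp; exact: fc|exact: gc].
Qed.

Lemma topdual0 (R : realType) (E : topologicalLmodType R) : topdual (fun _ : E => 0 : R).
Proof.
by split=> [a x y|x]; [rewrite mulr0 addr0|exact: cvg_cst].
Qed.

Lemma weak_open_eval (R : realType) (E : topologicalLmodType R) (f0 : E -> R)
  (X : E) (e : R) :
  weak_open (@topdual R E) (fun psi x => psi x)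
    [set psi | topdual psi /\ `|psi X - f0 X| < e].
Proof.
split=> [psi []//|psi [dpsi he]].
exists 1%N, (fun=> X), (e - `|psi X - f0 X|); rewrite subr_gt0; split => //.
move=> g dg /(_ ord0) hg; split => //.
have -> : g X - f0 X = (g X - psi X) + (psi X - f0 X) by ring.
by apply: le_lt_trans (ler_normD _ _) _; lra.
Qed.

(** The series is summed in the dual of [Y], where norm bounds give convergence, and transported by
    [J]. The function [c] is a cost that the weights must also make summable. *)
Lemma admissible_weighted_sum (R : realType) (E : tvsType R) (D : set (E -> R))
  (c : (E -> R) -> R) :
  admissible_pair E -> D `<=` @topdual R E -> D !=set0 ->
  (forall psi, 0 <= c psi) ->
  exists (g : nat -> E -> R) (w : nat -> R) (W : R) (F : E -> R),
  [/\ (forall i, D (g i)),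
      (forall i, 0 < w i /\ w i * c (g i) <= 2 ^- i.+1),
      topdual F,
      series w @ \oo --> W /\
        (forall X, series (fun i => w i * g i X) @ \oo --> F X) &
      forall phi X, D phi -> 0 < phi X -> exists i, 0 < g i X].
Proof.
move=> [Y [J [sepY [Jd [_ [Jsur [Jlin Jopen]]]]]]] Ddual [psi0 Dpsi0] c0.
(* Continuity of [J] for the weak topologies, tested on evaluation at [X]. *)
have key f X e : topdual f -> 0 < e -> exists n (p : 'I_n -> Y) d, 0 < d /\
    forall h, topdual h -> (forall i, `|h (p i) - f (p i)| < d) ->
    `|J h X - J f X| < e.
  move=> df e0; have [_ /(_ f)[]] := Jopen _ (weak_open_eval (J f) X e).
    by split => //; split; [exact: Jd|rewrite subrr normr0].
  move=> n [p [d [d0 hd]]]; exists n, p, d; split => // h dh hp.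
  by have [_ []] := hd h dh hp.
pose DY : set (Y -> R) := [set f | topdual f /\ D (J f)].
have DYdual : DY `<=` @topdual R Y by move=> f [].
have DY0 : DY !=set0.
  by have [f df Jf] := Jsur _ (Ddual _ Dpsi0); exists f; split => //; rewrite Jf.
have [h DYh hdense] := weak_dense_sequence sepY DYdual DY0.
have dh i : topdual (h i) by case: (DYh i).
have /choice[b hb] := fun i => topdual_bounded (dh i).
(* Dividing [2 ^- i.+1] by [s i] controls three series at once: the weights, the norms and the
   costs. *)
pose s i := 1 + (b i)%:R + c (J (h i)).
have s1 i : 1 <= s i by rewrite /s -addrA lerDl addr_ge0.
have s0 i : 0 < s i by apply: lt_le_trans (s1 i).
have i0 i : 0 < 2 ^- i.+1 :> R by rewrite invr_gt0 exprn_gt0.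
have [w [w0 ws]] : exists w : nat -> R,
    (forall i, 0 < w i) /\ (forall i, w i * s i = 2 ^- i.+1).
  exists (fun i => 2 ^- i.+1 / s i); split => i; first exact: divr_gt0.
  by rewrite divfK// gt_eqF.
have [|W wW _] := @half_dominated_series _ w 1 ler01.
  by move=> i; rewrite gtr0_norm// mulr1 -ws ler_peMr// ltW.
have [|F dF hF] := @series_topdual _ _ h w dh.
  move=> i y; rewrite normrM gtr0_norm// -ws -mulrA ler_pM2l//.
  apply: le_trans (hb i y) _; apply: ler_wpM2r => //.
  by rewrite /s -addrA addrCA lerDl addr_ge0.
have Sd n : topdual (fun y => series (fun i => w i * h i y) n) /\
    J (fun y => series (fun i => w i * h i y) n) =
    fun X => series (fun i => w i * J (h i) X) n.
  have Sn (T : Type) (k : nat -> T -> R) m :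
      (fun y => series (fun i => w i * k i y) m.+1) =
      (fun y => w m * k m y + series (fun i => w i * k i y) m).
    by apply/funext => y; rewrite /series/= big_nat_recr//= addrC.
  have S0 (T : Type) (k : nat -> T -> R) :
      (fun y => series (fun i => w i * k i y) 0%N) = (fun=> 0).
    by apply/funext => y; rewrite /series/= big_geq.
  elim: n => [|n [IHd IHJ]].
    rewrite !S0; split; first exact: topdual0.
    have := Jlin 1 _ _ (topdual0 Y) (topdual0 Y).
    rewrite (_ : (fun y : Y => 1 * 0 + 0 : R) = (fun=> 0)); last first.
      by apply/funext => y; rewrite mulr0 addr0.
    move=> J0; apply/funext => X; have := congr1 (@^~ X) J0; rewrite /=; lra.
  rewrite !Sn; split; first exact: topdual_comb.
  by rewrite Jlin// IHJ.
exists (fun i => J (h i)), w, W, (J F); split.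
- by move=> i; case: (DYh i).
- move=> i; split => //; rewrite -ws ler_pM2l// /s lerDr addr_ge0//.
- exact: Jd.
- split => // X; apply/cvgrPdist_lt => e e0.
  have [n [p [d [d0 hd]]]] := key F X e dF e0.
  have : \forall m \near \oo, forall j : 'I_n,
      `|F (p j) - series (fun i => w i * h i (p j)) m| < d.
    apply: filter_forall => j; exact: (cvgrPdist_lt _ _).1 (hF (p j)) d d0.
  apply: filterS => m hm; have := hd _ (Sd m).1.
  rewrite distrC (Sd m).2; apply => i; rewrite distrC; exact: hm.
(* Approximating [phi] at [X] with error below [phi X] forces a positive value. *)
- move=> phi X Dphi phi0; have [f df Jf] := Jsur _ (Ddual _ Dphi).
  have [n [p [d [d0 hd]]]] := key f X (phi X) df phi0.
  have [|i hi] := hdense f n p d _ d0; first by split => //; rewrite Jf.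
  exists i; have := hd _ (dh i) hi; rewrite Jf ltr_norml; lra.
Qed.

(** * Asymptotic cones and boundedness of sublevel sets *)

Lemma convex_cone_add (R : realType) (E : lmodType R) (A : set E) (X Y : E) :
  is_convex_cone A -> A X -> A Y -> A (X + Y).
Proof.
move=> [[_ Asc] Acvx] AX AY.
have h : A (2^-1 *: X + (1 - 2^-1) *: Y).
  by apply: convex_setP01 => //; apply/andP; split; lra.
have e1 : 2 * 2^-1 = 1 :> R by lra.
have e2 : 2 * (1 - 2^-1) = 1 :> R by lra.
by have := Asc 2 _ (ler0n _ _) h; rewrite scalerDr !scalerA e1 e2 !scale1r.
Qed.

(** Upper semicontinuity writes [V1 z] as [u - k] with [u] near [V1 x]; adding [k] back stays in
    [A], so [A] has points arbitrarily near [V1 x + Y]. *)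
Lemma usc_at_closed (R : realType) (N : nat) (E : tvsType R) (Xp A : set E)
  (V1 : 'rV[R]_N -> E) (x : 'rV[R]_N) (Y : E) :
  usc_at Xp V1 x -> closed A -> (forall X k, A X -> Xp k -> A (X + k)) ->
  (forall V, nbhs x V -> exists2 z, V z & A (V1 z + Y)) -> A (V1 x + Y).
Proof.
move=> uscx clA AXp hV; apply: clA => U nU.
have nU' : nbhs (V1 x) [set u | U (u + Y)].
  have := nbhsB (- Y) nU; rewrite addrC addrK.
  by apply: filterS => _ [z Uz <-]; rewrite /= addrC addrA subrr add0r.
have [V nV VU] := uscx _ nU'; have [z Vz Az] := hV _ nV.
have [u [k [Uu [Xk zE]]]] := VU z Vz.
exists (u + Y); split => //.
have -> : u + Y = V1 z + Y + k by rewrite zE addrAC subrK.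
exact: AXp.
Qed.

Lemma net_cvg_seq (T : topologicalType) (u : nat -> T) (l : T) :
  u @ \oo --> l -> net_cvg (fun i j => (i <= j)%N) u l.
Proof. by move=> ul U /ul [n0 _ h]; exists n0 => i; exact: h. Qed.

Lemma asym_cone_seq (R : realType) (E : topologicalLmodType R) (C : set E) (v : E)
  (xs : nat -> E) (ls : nat -> R) :
  (forall i, C (xs i)) -> (forall i, 0 <= ls i) -> ls @ \oo --> (0 : R) ->
  (fun i => ls i *: xs i) @ \oo --> v -> asym_cone C v.
Proof.
move=> Cx l0 lcvg xcvg.
exists nat, (fun i j => (i <= j)%N), xs, ls; split.
  split; first by constructor; exact: 0%N.
  split=> [//|]; split=> [i j k|i j]; first exact: leq_trans.
  by exists (maxn i j); rewrite leq_maxl leq_maxr.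
by do 2![split => //]; split; apply: net_cvg_seq.
Qed.

Lemma asym_cone_cone (R : realType) (E : topologicalLmodType R) (C : set E) :
  is_cone C -> C `<=` asym_cone C.
Proof.
move=> [_ Csc] v Cv.
apply: (@asym_cone_seq R E C v (fun i => i.+1%:R *: v) (fun i => i.+1%:R^-1)).
- by move=> i; apply: Csc.
- by move=> i; rewrite invr_ge0.
- exact: cvg_harmonic.
- under eq_fun do rewrite scalerA mulVf ?pnatr_eq0// scale1r.
  exact: cvg_cst.
Qed.

Lemma unit_sphere_compact (R : realType) (N : nat) :
  compact [set v : 'rV[R]_N | `|v| = 1].
Proof.
apply: bounded_closed_compact.
  by exists 1; split => // M M1 x /= ->; exact: ltW.
apply: (@preimage_closed _ _ (fun v : 'rV[R]_N => `|v|) [set x | x = 1]).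
  by move=> x _; exact: norm_continuous.
exact: closed_eq.
Qed.

Lemma unbounded_direction (R : realType) (N : nat) (S : set 'rV[R]_N) :
  (forall M : R, exists2 x, S x & M < `|x|) ->
  exists (y : nat -> 'rV[R]_N) (v : 'rV[R]_N), [/\ `|v| = 1,
    (forall j, S (y j) /\ j.+1%:R < `|y j|),
    (fun j => `|y j|^-1) @ \oo --> (0 : R) &
    (fun j => `|y j|^-1 *: y j) @ \oo --> v].
Proof.
move=> unb.
have /choice[x xP] : forall k : nat, exists z, S z /\ k.+1%:R < `|z|.
  by move=> k; have [z Sz zk] := unb k.+1%:R; exists z.
pose u k := `|x k|^-1 *: x k.
have x0 k : 0 < `|x k| by apply: lt_trans (xP k).2.
have u1 k : `|u k| = 1 by rewrite normrZ normfV normr_id mulVf// gt_eqF.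
have Fu : (u @ \oo) [set v : 'rV[R]_N | `|v| = 1] by exists 0%N => // i _; exact: u1.
have [v [v1 clv]] := @unit_sphere_compact R N (u @ \oo) _ Fu.
(* Indices are picked near the cluster point at rate [1 / (j + 1)]; [j <= n] keeps the norms
   growing. *)
have /choice[n nP] : forall j : nat, exists n, (j <= n)%N /\ `|v - u n| < j.+1%:R^-1.
  move=> j.
  have [_ [/= [i ji <-] bi]] : ((u @` [set i | (j <= i)%N]) `&` ball v j.+1%:R^-1) !=set0.
    apply: clv; last by apply: nbhsx_ballx; rewrite invr_gt0.
    by exists j => // i /= ji; exists i.
  by exists i; split => //; move: bi; rewrite -ball_normE.
have big j : j.+1%:R < `|x (n j)|.
  by apply: le_lt_trans (xP (n j)).2; rewrite ler_nat ltnS (nP j).1.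
exists (x \o n), v; split => //.
- by move=> j; split; [exact: (xP _).1|exact: big].
- apply: (@squeeze_cvgr _ _ _ _ (fun=> 0) (fun j => j.+1%:R^-1)).
  + apply: nearW => j; rewrite invr_ge0 normr_ge0/= lef_pV2 ?posrE//.
    exact: ltW.
  + exact: cvg_cst.
  + exact: cvg_harmonic.
- apply/cvgrPdist_lt => e e0.
  have /cvgrPdist_lt/(_ e e0) := @cvg_harmonic R.
  apply: filterS => j; rewrite sub0r normrN gtr0_norm /harmonic/= ?invr_gt0//.
  exact: lt_trans (nP j).2.
Qed.

(* A normalised limit direction of an unbounded sequence of such [x] lies in [L]. *)
Lemma sublevel_bounded (R : realType) (N : nat) (E : tvsType R) (Xp A : set E)
  (P : set 'rV[R]_N) (V0 : 'rV[R]_N -> R) (V1 : 'rV[R]_N -> E) :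
  (forall X k, A X -> Xp k -> A (X + k)) -> closed A -> is_convex_cone A ->
  anti_star_shaped Xp V1 -> usc Xp V1 -> Lset P V0 V1 A = [set 0] ->
  exists M : R, forall x, P x -> V0 x <= 1 -> A (V1 x) -> `|x| <= M.
Proof.
move=> AXp clA cA assV uscV L0; apply: contrapT => nb.
pose S : set 'rV[R]_N := [set x | P x /\ V0 x <= 1 /\ A (V1 x)].
have [|y [v [v1 yS ycvg vcvg]]] := @unbounded_direction R N S.
  move=> M; apply: contrapT => nM; apply: nb; exists M => x Px Vx Ax.
  by rewrite leNgt; apply/negP => Mx; apply: nM; exists x.
have yi j : 0 <= `|y j|^-1 by rewrite invr_ge0.
suff : Lset P V0 V1 A v.
  by rewrite L0 => /= v0; move: v1; rewrite v0 normr0 => /eqP; rewrite eq_sym oner_eq0.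
split; [|split].
- by apply: (asym_cone_seq (fun j => (yS j).1.1) yi).
(* [V0 (y j) <= 1] puts [(y j, 1)] in the epigraph, and the scaling sends the level 1 to 0. *)
- apply: (@asym_cone_seq R ('rV[R]_N * R^o)%type (epi V0) (v, 0)
    (fun j => (y j, 1)) (fun j => `|y j|^-1)) => //.
    by move=> j; exact: (yS j).1.2.1.
  have ycvg' : (fun j => `|y j|^-1 *: (1 : R^o)) @ \oo --> (0 : R^o).
    by under eq_fun do rewrite /GRing.scale/= mulr1.
  move=> U [[B C] /= [nB nC] BCU].
  have [i _ hi] := vcvg _ nB; have [k _ hk] := ycvg' _ nC.
  exists (maxn i k) => // j /=; rewrite geq_max => /andP[ij kj].
  by apply: (BCU (_, _)); split; [exact: hi|exact: hk].
(* As the norms exceed 1, anti-star-shapedness puts [V1] of the normalised points in [A], and upper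
   semicontinuity passes to the limit [v]. *)
- apply: asym_cone_cone; first by case: cA.
  rewrite -[V1 v]addr0; apply: (usc_at_closed (uscV v) clA AXp) => V nV.
  have [j _ hj] := vcvg _ nV.
  exists (`|y j|^-1 *: y j); first by apply: (hj j) => /=.
  have l01 : 0 <= `|y j|^-1 <= 1.
    rewrite yi/= invf_le1; last by apply: le_lt_trans (yS j).2.
    by apply: le_trans (ltW (yS j).2); rewrite ler1n.
  have := AXp _ _ (cA.1.2 _ _ (yi j) (yS j).1.2.2) (assV _ (y j) l01).
  by rewrite addr0 addrC subrK.
Qed.

(** * Dual representation of the risk measure *)

Lemma ereal_inf_bounded (R : realType) (T : Type) (S : set T) (f : T -> R) :
  (-oo < ereal_inf [set (f x)%:E | x in S])%E <->
  exists c, forall x, S x -> c <= f x.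
Proof.
split=> [h|[c hc]]; last first.
  apply: (@lt_le_trans _ _ c%:E); first by rewrite ltNyr.
  by apply/ereal_infP => _ [x Sx <-]; rewrite lee_fin hc.
case E : (ereal_inf _) h => [c| |]// _.
  exists c => x Sx; rewrite -lee_fin -E.
  by apply: ge_ereal_inf; exists (f x)%:E => //; exists x.
exists 0 => x Sx; have : (+oo <= (f x)%:E)%E.
  by rewrite -E; apply: ge_ereal_inf; exists (f x)%:E => //; exists x.
by rewrite leNgt ltry.
Qed.

Lemma sigmaPV_ge (R : realType) (N : nat) (E : tvsType R) (P : set 'rV[R]_N)
  (V0 : 'rV[R]_N -> R) (V1 : 'rV[R]_N -> E) (psi : E -> R) (c : R) :
  (forall x, P x -> c <= V0 x - psi (V1 x)) -> (c%:E <= sigmaPV P V0 V1 psi)%E.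
Proof. by move=> h; apply/ereal_infP => _ [x Px <-]; rewrite lee_fin h. Qed.

(** A negative value could be scaled along the cone down to [- (|c| + 1)], below [c]. *)
Lemma bounded_below_cone_ge0 (R : realType) (E : lmodType R) (A : set E)
  (f : E -> R) (c : R) :
  (forall (a : R) x y, f (a *: x + y) = a * f x + f y) -> is_cone A ->
  (forall X, A X -> c <= f X) -> forall X, A X -> 0 <= f X.
Proof.
move=> flin [_ Asc] fc X AX; rewrite leNgt; apply/negP => fX.
have [_ _ fZ _] := linear_formE flin.
have t0 : 0 <= (`|c| + 1) / - f X by rewrite divr_ge0 ?oppr_ge0 ?ltW// ltr_wpDl.
have := fc _ (Asc _ _ t0 AX); rewrite fZ invrN mulrN mulNr divfK ?lt_eqF//.
by have := ler_norm (- c); rewrite normrN; lra.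
Qed.

Lemma DsetP (R : realType) (N : nat) (E : tvsType R) (P : set 'rV[R]_N)
  (V0 : 'rV[R]_N -> R) (V1 : 'rV[R]_N -> E) (A : set E) (psi : E -> R) :
  is_cone A ->
  Dset P V0 V1 A psi <-> [/\ topdual psi, (forall X, A X -> 0 <= psi X) &
    exists c, forall x, P x -> c <= V0 x - psi (V1 x)].
Proof.
move=> cA; split=> [[dpsi [/ereal_inf_bounded[c hc] /ereal_inf_bounded hP]]|].
  by split => //; exact: bounded_below_cone_ge0 dpsi.1 cA hc.
move=> [dpsi pA hP]; split => //; split; last exact/ereal_inf_bounded.
by apply/ereal_inf_bounded; exists 0.
Qed.

Lemma rho_le (R : realType) (N : nat) (E : tvsType R) (P : set 'rV[R]_N)
  (V0 : 'rV[R]_N -> R) (V1 : 'rV[R]_N -> E) (A : set E) (X : E) (x : 'rV[R]_N) :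
  P x -> A (X + V1 x) -> (rho P V0 V1 A X <= (V0 x)%:E)%E.
Proof. by move=> Px AX; apply: ge_ereal_inf; exists (V0 x)%:E => //; exists x. Qed.

(** The affine minorant of [rho] is tested at [Y - V1 x] with [Y] in [A], where [rho] is at most
    [V0 x]. Taking [Y = 0] bounds [sigmaPV]; taking [x = 0] bounds [l] below on [A], hence makes it
    nonnegative there. *)
Lemma rho_dual_minorant (R : realType) (N : nat) (E : tvsType R) (P : set 'rV[R]_N)
  (V0 : 'rV[R]_N -> R) (V1 : 'rV[R]_N -> E) (A : set E) (X0 : E) (a : R) :
  P 0 -> V0 0 = 0 -> V1 0 = 0 -> is_cone A ->
  proper_efun (rho P V0 V1 A) -> convex_efun (rho P V0 V1 A) ->
  lower_semicontinuous (rho P V0 V1 A) -> (a%:E < rho P V0 V1 A X0)%E ->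
  exists2 psi, Dset P V0 V1 A psi &
    forall x, P x -> a + psi X0 <= V0 x - psi (V1 x).
Proof.
move=> P0 V00 V10 cA pr cr lr aX0.
have [l dl hl] := convex_lsc_affine_minorant pr cr lr aX0.
have [l0 lD _ lN] := linear_formE dl.1.
have h x Y : P x -> A Y -> a + l X0 <= V0 x - l (V1 x) + l Y.
  move=> Px AY.
  have : a + l X0 - l (Y - V1 x) <= V0 x by apply: hl; apply: rho_le; rewrite ?subrK.
  by rewrite lD lN; lra.
have hP x : P x -> a + l X0 <= V0 x - l (V1 x).
  by move=> Px; have := h x 0 Px cA.1; rewrite l0 addr0.
exists l => //; apply/DsetP => //; split => //; last by exists (a + l X0).
apply: (bounded_below_cone_ge0 (c := a + l X0)) => // [|X AX]; first exact: dl.1.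
by have := h 0 X P0 AX; rewrite V00 V10 l0 subr0 add0r.
Qed.

(* If every [phi] in [D] vanishes at [X], then [rho (- n X) <= 0] for all [n],
   by positions [x_n] which stay bounded; upper semicontinuity of [V1] at [0]
   along [x_n / n] gives [- X] in [A]. *)
Lemma Dset_separates (R : realType) (N : nat) (E : tvsType R) (Xp A : set E)
  (P : set 'rV[R]_N) (V0 : 'rV[R]_N -> R) (V1 : 'rV[R]_N -> E) (X : E) :
  P 0 -> V0 0 = 0 -> V1 0 = 0 -> (forall X k, A X -> Xp k -> A (X + k)) ->
  proper_efun (rho P V0 V1 A) -> convex_efun (rho P V0 V1 A) ->
  lower_semicontinuous (rho P V0 V1 A) ->
  closed A -> is_convex_cone A -> (forall X, A X -> A (- X) -> X = 0) ->
  anti_star_shaped Xp V1 -> usc Xp V1 -> Lset P V0 V1 A = [set 0] ->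
  A X -> X <> 0 -> exists2 phi, Dset P V0 V1 A phi & 0 < phi X.
Proof.
move=> P0 V00 V10 AXp pr cr lr clA cA pA assV uscV L0 AX Xn0.
have [M hM] := sublevel_bounded AXp clA cA assV uscV L0.
apply: contrapT => nphi; apply: Xn0; apply: pA => //.
have phiX phi : Dset P V0 V1 A phi -> phi X <= 0.
  by move=> Dphi; rewrite leNgt; apply/negP => h; apply: nphi; exists phi.
(* Otherwise the minorant at level [1 / 2], read at [x = 0], gives [n * phi X >= 1 / 2]. *)
have rho1 n : (rho P V0 V1 A (- (n%:R *: X))%R < 1%:E)%E.
  rewrite ltNge; apply/negP => rn.
  have h2 : ((2^-1)%:E < rho P V0 V1 A (- (n%:R *: X))%R)%E.
    by apply: lt_le_trans rn; rewrite lte_fin; lra.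
  have [phi Dphi hphi] := rho_dual_minorant P0 V00 V10 cA.1 pr cr lr h2.
  have [dphi _ _] := (DsetP P V0 V1 phi cA.1).1 Dphi.
  have [p0 _ pZ pN] := linear_formE dphi.1.
  have := hphi 0 P0; rewrite V00 V10 p0 pN pZ subr0.
  have : n%:R * phi X <= 0 by rewrite mulr_ge0_le0// phiX.
  lra.
(* Adding [n X], which lies in [A], gives [A (V1 x)], so the sublevel bound applies. *)
have xn n : exists x, [/\ P x, A (- (n%:R *: X) + V1 x) & `|x| <= M].
  have [_ [x [Px Ax] <-]] := ereal_inf_lt (rho1 n).
  rewrite lte_fin => Vx; exists x; split => //; apply: hM => //; first exact: ltW.
  rewrite -[V1 x](addrNK (- (n%:R *: X))) opprK addrAC [V1 x + _]addrC.
  by apply: convex_cone_add => //; apply: cA.1.2.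
rewrite -[- X]add0r -{1}V10; apply: (usc_at_closed (uscV 0) clA AXp) => V nV.
have /nbhs_ballP[e /= e0 eV] := nV.
pose n := (Num.bound (M / e)).+1.
have n0 : 0 < n%:R :> R by [].
have [x [Px Ax xM]] := xn n.
have M0 : 0 <= M := le_trans (normr_ge0 x) xM.
have ni : 0 <= n%:R^-1 :> R by rewrite invr_ge0.
exists (n%:R^-1 *: x).
  apply: eV; rewrite -ball_normE /ball_ /= sub0r normrN normrZ gtr0_norm ?invr_gt0//.
  rewrite mulrC ltr_pdivrMr//; apply: le_lt_trans xM _.
  rewrite mulrC -ltr_pdivrMr//.
  apply: (@lt_trans _ _ (Num.bound (M / e))%:R); last by rewrite ltr_nat.
  by apply: archi_boundP; rewrite divr_ge0// ltW.
have l01 : 0 <= (n%:R^-1 : R) <= 1 by rewrite ni invf_le1//= ler1n.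
have := AXp _ _ (cA.1.2 _ _ ni Ax) (assV _ x l01).
rewrite scalerDr scalerN scalerA mulVf ?gt_eqF// scale1r.
by rewrite -addrA [_ *: V1 x + _]addrC subrK addrC.
Qed.

Lemma series_lim_ge_term (R : realType) (u : nat -> R) (l : R) (i : nat) :
  (forall j, 0 <= u j) -> series u @ \oo --> l -> u i <= l.
Proof.
move=> u0 ul; apply: (cvgr_to_ge ul); exists i.+1 => // n /= ni.
apply: (@le_trans _ _ (series u i.+1)).
  by rewrite /series/= big_nat_recr//= lerDr sumr_ge0.
exact: (@nondecreasing_series _ u xpredT 0%N).
Qed.

(* The weights are chosen small enough to keep [sigmaPV] finite for the sum. *)
Lemma Dstr_nonempty (R : realType) (N : nat) (E : tvsType R) (A : set E)
  (P : set 'rV[R]_N) (V0 : 'rV[R]_N -> R) (V1 : 'rV[R]_N -> E) :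
  admissible_pair E -> is_cone A -> Dset P V0 V1 A !=set0 ->
  (forall X, A X -> X <> 0 -> exists2 phi, Dset P V0 V1 A phi & 0 < phi X) ->
  Dstr P V0 V1 A !=set0.
Proof.
move=> adm cA D0 sepD.
(* The cost [c psi] bounds how far [sigmaPV] lies below 0; outside [D] it is set to 0. *)
have /choice[c cP] : forall psi : E -> R, exists c : R, 0 <= c /\
    (Dset P V0 V1 A psi -> forall x, P x -> - c <= V0 x - psi (V1 x)).
  move=> psi; have [Dpsi|nD] := pselect (Dset P V0 V1 A psi); last by exists 0.
  have [_ _ [d hd]] := (DsetP P V0 V1 psi cA).1 Dpsi.
  exists `|d|; split => // _ x Px; apply: le_trans (hd x Px).
  by have := ler_norm (- d); rewrite normrN; lra.
have Ddual : Dset P V0 V1 A `<=` @topdual R E by move=> psi [].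
have [g [w [W [F [Dg wc dF [wW gF] gsep]]]]] :=
  admissible_weighted_sum adm Ddual D0 (fun psi => (cP psi).1).
have w0 i : 0 <= w i by apply: ltW; case: (wc i).
have W0 : 0 < W by apply: lt_le_trans (wc 0%N).1 _; exact: series_lim_ge_term.
have gA i X : A X -> 0 <= g i X.
  by move=> AX; have [_ h _] := (DsetP P V0 V1 (g i) cA).1 (Dg i); exact: h.
have FA X : A X -> X <> 0 -> 0 < F X.
  move=> AX Xn0; have [phi Dphi phiX] := sepD X AX Xn0.
  have [i gi] := gsep phi X Dphi phiX.
  apply: (@lt_le_trans _ _ (w i * g i X)); first by rewrite mulr_gt0//; case: (wc i).
  apply: (@series_lim_ge_term _ (fun i => w i * g i X)) => // j.
  by rewrite mulr_ge0// gA.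
(* The weighted sum pairs [F] with [W * V0]; dividing by the total weight [W] restores the
   coefficient 1 of [V0]. *)
have dWF : topdual (fun X => W^-1 * F X).
  have := topdual_comb W^-1 dF (topdual0 E).
  by under eq_fun do rewrite addr0.
have strict X : A X -> X <> 0 -> 0 < W^-1 * F X.
  by move=> AX Xn0; rewrite mulr_gt0 ?invr_gt0// FA.
exists (fun X => W^-1 * F X); split => //.
apply/DsetP => //; split => //.
  move=> X AX; have [->|Xn0] := eqVneq X 0.
    by have [-> _ _ _] := linear_formE dF.1; rewrite mulr0.
  by apply/ltW/strict => //; exact/eqP.
exists (- W^-1) => x Px.
(* Termwise, [w i * (V0 x - g i (V1 x))] is at least [- w i * c (g i)], hence at least
   [- 2 ^- i.+1]. *)
suff : -1 <= W * V0 x - F (V1 x).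
  rewrite -(ler_pM2l (x := W^-1)) ?invr_gt0// mulrN1 mulrBr mulrA mulVf ?gt_eqF//.
  by rewrite mul1r.
have h : (fun n => series w n * V0 x - series (fun i => w i * g i (V1 x)) n) @ \oo
    --> W * V0 x - F (V1 x).
  by apply: cvgB; [exact: cvgMr_tmp|exact: gF].
apply: (cvgr_to_ge h); apply: nearW => n.
rewrite /series/= mulr_suml -sumrB -[X in - X <= _]/1.
apply: (@le_trans _ _ (\sum_(0 <= i < n) - (2 ^- i.+1))).
  by rewrite sumrN lerN2 sum_half_le1.
apply: ler_sum => i _; rewrite -mulrBr.
have := (cP (g i)).2 (Dg i) x Px; have := (wc i).2; have := w0 i; nra.
Qed.

(** Elements of [D] are nonnegative on [A], so any positive weight on [psi] keeps strictness. The
    weights sum to 1, so the lower bounds mix linearly; the explicit bound serves to choose [t]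
    later. *)
Lemma Dstr_comb (R : realType) (N : nat) (E : tvsType R) (A : set E)
  (P : set 'rV[R]_N) (V0 : 'rV[R]_N -> R) (V1 : 'rV[R]_N -> E)
  (psi phi : E -> R) (t c d : R) :
  is_cone A -> Dstr P V0 V1 A psi -> Dset P V0 V1 A phi -> 0 < t < 1 ->
  (forall x, P x -> c <= V0 x - psi (V1 x)) ->
  (forall x, P x -> d <= V0 x - phi (V1 x)) ->
  Dstr P V0 V1 A (fun X => t * psi X + (1 - t) * phi X) /\
  forall x, P x ->
    t * c + (1 - t) * d <= V0 x - (t * psi (V1 x) + (1 - t) * phi (V1 x)).
Proof.
move=> cA [Dpsi psi0] Dphi /andP[t0 t1] hc hd.
have [dpsi psiA _] := (DsetP P V0 V1 psi cA).1 Dpsi.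
have [dphi phiA _] := (DsetP P V0 V1 phi cA).1 Dphi.
have bnd x : P x ->
    t * c + (1 - t) * d <= V0 x - (t * psi (V1 x) + (1 - t) * phi (V1 x)).
  by move=> Px; have := hc x Px; have := hd x Px; nra.
split => //; split; last first.
  by move=> X AX Xn0; have := psi0 X AX Xn0; have := phiA X AX; nra.
apply/DsetP => //; split.
- apply: topdual_comb => //.
  by have := topdual_comb (1 - t) dphi (topdual0 E); under eq_fun do rewrite addr0.
- by move=> X AX; have := psiA X AX; have := phiA X AX; nra.
- by exists (t * c + (1 - t) * d).
Qed.

Theorem mainTheorem17 (R : realType) (E : tvsType R) (Xp : set E) (N : nat)
  (P : set 'rV[R]_N) (V0 : 'rV[R]_N -> R) (V1 : 'rV[R]_N -> E) (A : set E) :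
  (* standing assumptions *)
  is_convex_cone Xp ->
  P 0 ->
  V0 0 = 0 -> (forall x, - V0 (- x) <= V0 x) ->
  V1 0 = 0 -> (forall x, cone_le Xp (V1 x) (- V1 (- x))) ->
  A 0 -> (forall X k, A X -> Xp k -> A (X + k)) ->
  (* hypotheses of the theorem (E locally convex: built into tvsType) *)
  proper_efun (rho P V0 V1 A) ->
  convex_efun (rho P V0 V1 A) ->
  lower_semicontinuous (rho P V0 V1 A) ->
  admissible_pair E ->
  closed A -> is_convex_cone A -> (forall X, A X -> A (- X) -> X = 0) ->
  closed P ->
  lower_semicontinuous (fun x => (V0 x)%:E) ->
  anti_star_shaped Xp V1 -> usc Xp V1 ->
  Lset P V0 V1 A = [set 0] ->
  (Dstr P V0 V1 A !=set0) /\
  (forall psi, Dstr P V0 V1 A psi -> sigmaA A psi = 0%E) /\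
  (forall X : E, rho P V0 V1 A X =
     ereal_sup [set (sigmaPV P V0 V1 psi - (psi X)%:E)%E | psi in Dstr P V0 V1 A]).
Proof.
move=> _ P0 V00 _ V10 _ _ AXp pr cr lr adm clA cA pA _ _ assV uscV L0.
have coneA : is_cone A by case: cA.
have [psi0 Dpsi0] : Dstr P V0 V1 A !=set0.
  apply: Dstr_nonempty => //.
    (* [D] is nonempty because [rho] avoids [-oo]: any real below [rho X1] yields a minorant. *)
    have [rN [X1 _]] := pr; have : exists a : R, (a%:E < rho P V0 V1 A X1)%E.
      case E1 : (rho P V0 V1 A X1) (rN X1) => [r| |]// _.
        by exists (r - 1); rewrite lte_fin; lra.
      by exists 0; rewrite ltry.
    move=> [a aX1].
    by have [phi Dphi _] := rho_dual_minorant P0 V00 V10 coneA pr cr lr aX1; exists phi.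
  move=> X AX Xn0.
  exact: (Dset_separates P0 V00 V10 AXp pr cr lr clA cA pA assV uscV L0 AX Xn0).
split; first by exists psi0.
split.
  move=> psi [Dpsi _]; have [dpsi psiA _] := (DsetP P V0 V1 psi coneA).1 Dpsi.
  apply/eqP; rewrite eq_le; apply/andP; split.
    apply: ge_ereal_inf; exists 0%E => //; exists 0; first by case: coneA.
    by have [-> _ _ _] := linear_formE dpsi.1.
  by apply/ereal_infP => _ [X AX <-]; rewrite lee_fin psiA.
move=> X; apply/eqP; rewrite eq_le; apply/andP; split; last first.
  (* Weak duality: [psi] is nonnegative at [X + V1 x]. *)
  apply/ereal_supP => _ [psi [Dpsi _] <-].
  have [dpsi psiA _] := (DsetP P V0 V1 psi coneA).1 Dpsi.
  have [_ pD _ _] := linear_formE dpsi.1.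
  apply/ereal_infP => _ [x [Px Ax] <-].
  rewrite leeBlDr//; apply: (@le_trans _ _ (V0 x - psi (V1 x))%:E).
    by apply: ge_ereal_inf; exists (V0 x - psi (V1 x))%:E => //; exists x.
  by rewrite -EFinD lee_fin; have := psiA _ Ax; rewrite pD; lra.
set S := ereal_sup _.
(* If [S] were below [rho X], two reals [a < b] would fit strictly between them. The room from [b]
   down to [a] pays for mixing in [psi0]. *)
suff le_S (a b : R) : a < b -> (b%:E < rho P V0 V1 A X)%E -> (a%:E <= S)%E.
  rewrite leNgt; apply/negP => Sr.
  case E1 : (rho P V0 V1 A X) Sr le_S => [r| |]; case: S => [s| |]//=.
  - rewrite lte_fin => sr /(_ ((s *+ 2 + r) / 3) ((s + r) / 2)).
    by rewrite lte_fin lee_fin mulr2n => h; have := h ltac:(lra) ltac:(lra); lra.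
  - move=> _ /(_ (r - 2) (r - 1)); rewrite lte_fin => h.
    by have := h ltac:(lra) ltac:(lra); rewrite leNgt ltNyr.
  - move=> _ /(_ (s + 1) (s + 2)); rewrite ltry lee_fin => h.
    by have := h ltac:(lra) isT; lra.
  - move=> _ /(_ 0 1 ltr01); rewrite ltry => /(_ isT).
    by rewrite leNgt ltNyr.
move=> ab br.
have [phi Dphi hphi] := rho_dual_minorant P0 V00 V10 coneA pr cr lr br.
have [_ _ [c hc]] := (DsetP P V0 V1 psi0 coneA).1 Dpsi0.1.
(* The mixture guarantees [b - t * (b - (c - psi0 X))] at [X]. This [k] exceeds both
   [b - (c - psi0 X)] and [b - a], so [t = (b - a) / k] lies in [(0, 1)] and loses at most
   [b - a]. *)
pose k := `|b - (c - psi0 X)| + 1 + (b - a).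
have nk := ler_norm (b - (c - psi0 X)); have nk0 := normr_ge0 (b - (c - psi0 X)).
have k0 : 0 < k by rewrite /k; lra.
pose t := (b - a) / k.
have tk : t * k = b - a by rewrite /t divfK// gt_eqF.
have t01 : 0 < t < 1.
  by rewrite /t divr_gt0 ?subr_gt0//= ltr_pdivrMr// mul1r /k; lra.
have [Dt ht] := Dstr_comb coneA Dpsi0 Dphi t01 hc hphi.
pose psi Z := t * psi0 Z + (1 - t) * phi Z.
apply: le_ereal_sup_tmp.
exists (sigmaPV P V0 V1 psi - (psi X)%:E)%E; first by exists psi.
rewrite leeBrDr// -EFinD; apply: sigmaPV_ge => x Px.
apply: le_trans (ht x Px); rewrite /psi.
have /andP[t0 t1] := t01.
have : t * (b - (c - psi0 X)) <= b - a.
  by rewrite -tk ler_pM2l// /k; lra.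
lra.
Qed.
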